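(* Let $M$ be a normal metric contact pair manifold of dimension $m=2p+2q+2$ with scalar curvature $scal\neq m-2$. If the relation $$Ric(X_2,X_3)Ric(X_1,X_4)-Ric(X_1,X_3)Ric(X_2,X_4)=\tfrac12(scal-m+2)\big[g(X_2,X_3)g(X_1,X_4)-g(X_1,X_3)g(X_2,X_4)\big]$$ holds on $M$ for all $X_1,X_2,X_3,X_4\in\Gamma(TM)$, then $M$ is a generalized quasi-Einstein manifold.
   Context: A contact pair of type $(p,q)$ ($p,q$ positive integers) on a differentiable manifold $M$ of dimension $m=2p+2q+2$ is a pair of $1$-forms $(\alpha_1,\alpha_2)$ with $\alpha_1\wedge(d\alpha_1)^p\wedge\alpha_2\wedge(d\alpha_2)^q\neq 0$ everywhere, $(d\alpha_1)^{p+1}=0$ and $(d\alpha_2)^{q+1}=0$. Its Reeb vector fields $Z_1,Z_2$ are the unique vector fields with $\alpha_i(Z_j)=\delta_{ij}$ and $i_{Z_i}d\alpha_j=0$ for $i,j\in\{1,2\}$. An almost contact pair structure is $(\alpha_1,\alpha_2,\phi)$ with $\phi$ a $(1,1)$-tensor field satisfying $\phi^2=-I+\alpha_1\otimes Z_1+\alpha_2\otimes Z_2$ and $\phi Z_1=\phi Z_2=0$ (then $\phi$ has rank $2p+2q$ and $\alpha_i\circ\phi=0$). Throughout, $\phi$ is assumed decomposable, i.e. $T\mathcal F_i=\ker\alpha_i\cap\ker d\alpha_i$ is $\phi$-invariant for $i=1,2$. A Riemannian metric $g$ is associated if $g(X,\phi Y)=(d\alpha_1+d\alpha_2)(X,Y)$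 and $g(X,Z_i)=\alpha_i(X)$ for $i=1,2$; with such $g$, $(M,\phi,Z_1,Z_2,\alpha_1,\alpha_2,g)$ is a metric (almost) contact pair manifold. Here $d\alpha(X,Y)=\frac12\big(X\alpha(Y)-Y\alpha(X)-\alpha([X,Y])\big)$. It is normal if the almost complex structures $J=\phi-\alpha_2\otimes Z_1+\alpha_1\otimes Z_2$ and $T=\phi+\alpha_2\otimes Z_1-\alpha_1\otimes Z_2$ are both integrable. $Ric$ is the Ricci tensor of $g$ and $scal$ (the $g$-trace of $Ric$) its scalar curvature. A normal metric contact pair manifold is generalized quasi-Einstein if there are functions $\lambda,\beta,\mu$ on $M$ with $Ric(X_1,X_2)=\lambda g(X_1,X_2)+\beta\alpha_1(X_1)\alpha_1(X_2)+\mu\alpha_2(X_1)\alpha_2(X_2)$ for all $X_1,X_2\in\Gamma(TM)$. *)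

(* Defs.v *)
From mathcomp Require Import all_boot all_order all_algebra perm.
From mathcomp Require Import all_classical all_reals all_analysis.

Set Implicit Arguments.
Unset Strict Implicit.
Unset Printing Implicit Defensive.

Import Order.TTheory GRing.Theory Num.Theory numFieldNormedType.Exports.
Local Open Scope classical_set_scope.
Local Open Scope ring_scope.

Section Smooth.
Variables (R : realType) (V W : normedModType R).

(* For [V] finite-dimensional, asking that every directional derivative be
   C^k is the same as asking it of the differential. *)
Fixpoint Ck (k : nat) (U : set V) (f : V -> W) : Prop :=
  if k is k'.+1 then
    (forall u, U u -> differentiable f u) /\ (forall v, Ck k' U ('D_v f))
  else forall u, U u -> {for u, continuous f}.

Definition smooth_on (U : set V) (f : V -> W) : Prop := forall k, Ck k U f.

End Smooth.

(* [coord] and [point] are total functions, meaningful only on [dom] and on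
   [coord @` dom], which they identify homeomorphically. *)
Record chart (R : realType) (m : nat) (M : topologicalType) := Chart {
  dom : set M;
  coord : M -> 'rV[R]_m;
  point : 'rV[R]_m -> M;
  dom_open : open dom;
  img_open : open (coord @` dom);
  coordK : forall x, dom x -> point (coord x) = x;
  coord_continuous : forall x, dom x -> {for x, continuous coord};
  point_continuous : forall u, (coord @` dom) u -> {for u, continuous point} }.

(* The atlas need not be maximal.  [chart_at x] is a preferred chart at [x]:
   the tangent space T_x M is represented by 'rV[R]_m, a tangent vector being
   the row of its components in the chart [chart_at x]. *)
Record smooth_manifold (R : realType) (m : nat) := SmoothManifold {
  carrier :> topologicalType;
  atlas : set (chart R m carrier);
  chart_at : carrier -> chart R m carrier;
  manifold_hausdorff : hausdorff_space carrier;
  manifold_second_countable : @second_countable carrier;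
  chart_at_atlas : forall x, atlas (chart_at x);
  chart_at_dom : forall x, dom (chart_at x) x;
  transition_smooth : forall c c', atlas c -> atlas c' ->
    smooth_on (coord c @` (dom c `&` dom c')) (coord c' \o point c) }.

Section Calculus.
Variables (R : realType) (m : nat) (M : smooth_manifold R m).

Implicit Types (c : chart R m M) (f : M -> R) (x : M).

(* Sections of the tensor bundles, not assumed smooth: at [x], a covector is a
   column [a] with v |-> v *m a, an endomorphism is a matrix [A] with
   v |-> v *m A, a bilinear form is a matrix [B] with (v, w) |-> v *m B *m w^T,
   all relative to the chart [chart_at x]. *)
Definition vfield := M -> 'rV[R]_m.
Definition covfield := M -> 'cV[R]_m.
Definition endofield := M -> 'M[R]_m.
Definition bilfield := M -> 'M[R]_m.

Implicit Types (X Y Z W : vfield) (a : covfield) (A J : endofield).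
Implicit Types (B g : bilfield).

(* Components in the chart [c'] of v : T_x M are [v *m transition c c' x] if
   [v] is the row of its components in the chart [c]. *)
Definition transition c c' x : 'M[R]_m :=
  jacobian (coord c' \o point c) (coord c x).

Definition vfield_rep c X (u : 'rV[R]_m) : 'rV[R]_m :=
  let x := point c u in X x *m transition (chart_at x) c x.

Definition covfield_rep c a (u : 'rV[R]_m) : 'cV[R]_m :=
  let x := point c u in transition c (chart_at x) x *m a x.

Definition endofield_rep c A (u : 'rV[R]_m) : 'M[R]_m :=
  let x := point c u in
  transition c (chart_at x) x *m A x *m transition (chart_at x) c x.

Definition bilfield_rep c B (u : 'rV[R]_m) : 'M[R]_m :=
  let x := point c u in
  transition c (chart_at x) x *m B x *m (transition c (chart_at x) x)^T.

Definition smooth_fun f : Prop :=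
  forall c, atlas c -> smooth_on (coord c @` dom c) (f \o point c).

Definition smooth_vfield X : Prop :=
  forall c, atlas c -> smooth_on (coord c @` dom c) (vfield_rep c X).

Definition smooth_covfield a : Prop :=
  forall c, atlas c -> smooth_on (coord c @` dom c) (covfield_rep c a).

Definition smooth_endofield A : Prop :=
  forall c, atlas c -> smooth_on (coord c @` dom c) (endofield_rep c A).

Definition smooth_bilfield B : Prop :=
  forall c, atlas c -> smooth_on (coord c @` dom c) (bilfield_rep c B).

Definition vadd X Y : vfield := fun x => X x + Y x.
Definition vscale f X : vfield := fun x => f x *: X x.

Definition pair1 a X : M -> R := fun x => (X x *m a x) 0 0.
Definition endo_app A X : vfield := fun x => X x *m A x.
Definition pair2 B X Y : M -> R := fun x => (X x *m B x *m (Y x)^T) 0 0.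

(* a (x) Z, i.e. X |-> a(X) Z *)
Definition tens a Z : endofield := fun x => a x *m Z x.

(* X f *)
Definition vact X f : M -> R := fun x =>
  let c := chart_at x in 'D_(X x) (f \o point c) (coord c x).

(* [X, Y]^i = X^j d_j Y^i - Y^j d_j X^i in the chart at [x]. *)
Definition bracket X Y : vfield := fun x =>
  let c := chart_at x in
  'D_(X x) (vfield_rep c Y) (coord c x) - 'D_(Y x) (vfield_rep c X) (coord c x).

Definition ext_d a X Y : M -> R := fun x =>
  2^-1 * (vact X (pair1 a Y) x - vact Y (pair1 a X) x
          - pair1 a (bracket X Y) x).

Definition form (k : nat) := ('I_k -> vfield) -> M -> R.

Definition form_of_covfield a : form 1 :=
  fun X : 'I_1 -> vfield => pair1 a (X ord0).
Definition form_d a : form 2 :=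
  fun X : 'I_2 -> vfield => ext_d a (X ord0) (X ord_max).

(* The wedge product is the alternation of the tensor product, the
   normalisation that matches the factor 1/2 in [ext_d]. *)
Definition wedge k l (w : form k) (t : form l) : form (k + l) :=
  fun (X : 'I_(k + l) -> vfield) x =>
  ((k + l)`!)%:R^-1 *
  \sum_(s : 'S_(k + l)) (-1) ^+ s * w (fun i => X (s (lshift l i))) x
                                  * t (fun j => X (s (rshift k j))) x.

Fixpoint wedge_pow k (w : form k) (n : nat) : form (n * k) :=
  if n is n'.+1 then wedge w (@wedge_pow k w n') else fun _ _ => 1.
Arguments wedge_pow {k} w n.

Definition form_zero k (w : form k) : Prop :=
  forall X : 'I_k -> vfield, (forall i, smooth_vfield (X i)) ->
  forall x, w X x = 0.

Definition form_nowhere_zero k (w : form k) : Prop :=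
  forall x, exists2 X : 'I_k -> vfield,
    (forall i, smooth_vfield (X i)) & w X x != 0.

Record riemannian_metric g : Prop := RiemannianMetric {
  metric_smooth : smooth_bilfield g;
  metric_sym : forall x, (g x)^T = g x;
  metric_pos : forall x (v : 'rV[R]_m), v != 0 -> 0 < (v *m g x *m v^T) 0 0 }.

Record levi_civita g (nabla : vfield -> vfield -> vfield) : Prop := LeviCivita {
  nabla_smooth : forall X Y, smooth_vfield X -> smooth_vfield Y ->
    smooth_vfield (nabla X Y);
  nabla_addl : forall X X' Y,
    smooth_vfield X -> smooth_vfield X' -> smooth_vfield Y ->
    nabla (vadd X X') Y = vadd (nabla X Y) (nabla X' Y);
  nabla_scalel : forall f X Y,
    smooth_fun f -> smooth_vfield X -> smooth_vfield Y ->
    nabla (vscale f X) Y = vscale f (nabla X Y);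
  nabla_addr : forall X Y Y',
    smooth_vfield X -> smooth_vfield Y -> smooth_vfield Y' ->
    nabla X (vadd Y Y') = vadd (nabla X Y) (nabla X Y');
  nabla_leibniz : forall f X Y,
    smooth_fun f -> smooth_vfield X -> smooth_vfield Y ->
    nabla X (vscale f Y) = vadd (vscale (vact X f) Y) (vscale f (nabla X Y));
  nabla_torsion_free : forall X Y, smooth_vfield X -> smooth_vfield Y ->
    forall x, nabla X Y x - nabla Y X x = bracket X Y x;
  nabla_metric : forall X Y Z,
    smooth_vfield X -> smooth_vfield Y -> smooth_vfield Z ->
    forall x, vact X (pair2 g Y Z) x =
      pair2 g (nabla X Y) Z x + pair2 g Y (nabla X Z) x }.

Definition curvature (nabla : vfield -> vfield -> vfield) X Y Z : vfield :=
  fun x => nabla X (nabla Y Z) x - nabla Y (nabla X Z) x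
           - nabla (bracket X Y) Z x.

(* The matrix of the endomorphism Z |-> R(Z, X) Y of T_x M; it exists by
   tensoriality and is unique because smooth fields span T_x M. *)
Definition ricci_endo nabla X Y x : 'M[R]_m :=
  xget 0 [set A : 'M[R]_m | forall Z, smooth_vfield Z ->
    curvature nabla Z X Y x = Z x *m A].

Definition ricci nabla X Y : M -> R := fun x => \tr (ricci_endo nabla X Y x).

(* The matrix of the bilinear form Ric on T_x M, likewise unique. *)
Definition ricci_mx nabla x : 'M[R]_m :=
  xget 0 [set B : 'M[R]_m | forall X Y, smooth_vfield X -> smooth_vfield Y ->
    ricci nabla X Y x = (X x *m B *m (Y x)^T) 0 0].

Definition scal g nabla : M -> R := fun x =>
  \tr (invmx (g x) *m ricci_mx nabla x).

Record contact_pair (p q : nat) (a1 a2 : covfield) : Prop := ContactPair {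
  type_pos : (0 < p)%N /\ (0 < q)%N;
  contact_dim : m = (2 * p + 2 * q + 2)%N;
  forms_smooth : smooth_covfield a1 /\ smooth_covfield a2;
  contact_nondegenerate : form_nowhere_zero
    (wedge (form_of_covfield a1) (wedge (wedge_pow (form_d a1) p)
      (wedge (form_of_covfield a2) (wedge_pow (form_d a2) q))));
  class_left : form_zero (wedge_pow (form_d a1) p.+1);
  class_right : form_zero (wedge_pow (form_d a2) q.+1) }.

Record reeb_fields (a1 a2 : covfield) (Z1 Z2 : vfield) : Prop := ReebFields {
  reeb_smooth : smooth_vfield Z1 /\ smooth_vfield Z2;
  reeb11 : forall x, pair1 a1 Z1 x = 1;
  reeb12 : forall x, pair1 a1 Z2 x = 0;
  reeb21 : forall x, pair1 a2 Z1 x = 0;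
  reeb22 : forall x, pair1 a2 Z2 x = 1;
  reeb_d : forall Y, smooth_vfield Y -> forall x,
    [/\ ext_d a1 Z1 Y x = 0, ext_d a1 Z2 Y x = 0,
        ext_d a2 Z1 Y x = 0 & ext_d a2 Z2 Y x = 0] }.

Record almost_contact_structure (a1 a2 : covfield) (Z1 Z2 : vfield)
    (phi : endofield) : Prop := AlmostContactStructure {
  phi_smooth : smooth_endofield phi;
  phi_square : forall x,
    phi x *m phi x = - 1%:M + tens a1 Z1 x + tens a2 Z2 x;
  phi_reeb1 : forall x, endo_app phi Z1 x = 0;
  phi_reeb2 : forall x, endo_app phi Z2 x = 0 }.

(* The vector X(x) lies in ker a /\ ker da. *)
Definition in_char_dist a X x : Prop :=
  pair1 a X x = 0 /\ forall Y, smooth_vfield Y -> ext_d a X Y x = 0.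

Definition decomposable (a1 a2 : covfield) (phi : endofield) : Prop :=
  forall X, smooth_vfield X -> forall x,
    (in_char_dist a1 X x -> in_char_dist a1 (endo_app phi X) x) /\
    (in_char_dist a2 X x -> in_char_dist a2 (endo_app phi X) x).

Record associated_metric (a1 a2 : covfield) (Z1 Z2 : vfield) (phi : endofield)
    g : Prop := AssociatedMetric {
  associated_phi : forall X Y, smooth_vfield X -> smooth_vfield Y ->
    forall x, pair2 g X (endo_app phi Y) x = ext_d a1 X Y x + ext_d a2 X Y x;
  associated_reeb1 : forall X, smooth_vfield X ->
    forall x, pair2 g X Z1 x = pair1 a1 X x;
  associated_reeb2 : forall X, smooth_vfield X ->
    forall x, pair2 g X Z2 x = pair1 a2 X x }.

Record metric_contact_pair (p q : nat) (phi : endofield) (Z1 Z2 : vfield)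
    (a1 a2 : covfield) g : Prop := MetricContactPair {
  mcp_contact : contact_pair p q a1 a2;
  mcp_reeb : reeb_fields a1 a2 Z1 Z2;
  mcp_structure : almost_contact_structure a1 a2 Z1 Z2 phi;
  mcp_decomposable : decomposable a1 a2 phi;
  mcp_riemannian : riemannian_metric g;
  mcp_associated : associated_metric a1 a2 Z1 Z2 phi g }.

(* Vanishing of the Nijenhuis torsion of an almost complex structure. *)
Definition integrable J : Prop :=
  forall X Y, smooth_vfield X -> smooth_vfield Y -> forall x,
    bracket (endo_app J X) (endo_app J Y) x - bracket X Y x
    - endo_app J (bracket (endo_app J X) Y) x
    - endo_app J (bracket X (endo_app J Y)) x = 0.

Definition normal (phi : endofield) (Z1 Z2 : vfield) (a1 a2 : covfield)
    : Prop :=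
  integrable (fun x => phi x - tens a2 Z1 x + tens a1 Z2 x) /\
  integrable (fun x => phi x + tens a2 Z1 x - tens a1 Z2 x).

Definition generalized_quasi_einstein (a1 a2 : covfield) g
    (nabla : vfield -> vfield -> vfield) : Prop :=
  exists lambda beta mu : M -> R,
    [/\ smooth_fun lambda, smooth_fun beta, smooth_fun mu &
     forall X1 X2, smooth_vfield X1 -> smooth_vfield X2 -> forall x,
       ricci nabla X1 X2 x =
         lambda x * pair2 g X1 X2 x
         + beta x * (pair1 a1 X1 x * pair1 a1 X2 x)
         + mu x * (pair1 a2 X1 x * pair1 a2 X2 x)].

End Calculus.

(* Main.v *)
Require Import Defs.
From mathcomp Require Import all_boot all_order all_algebra.
From mathcomp Require Import all_classical all_reals all_analysis.
From mathcomp Require Import perm ring zify.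

(** The curvature identity forces the Ricci tensor to be a multiple of the
    metric.  Put k = (scal - m + 2) / 2, which is nonzero by hypothesis.  At a
    point, the identity says that the 2x2 minors of Ric, read in a pair of
    g-dual bases, are k times those of the identity matrix.  As soon as m > 2
    this makes Ric proportional to g, with a factor l satisfying l ^ 2 = k
    ([proportional_of_minors]); since the first Reeb field Z1 has length 1,
    l = Ric(Z1, Z1).  So M is even Einstein, and the coefficients of
    a1 (x) a1 and a2 (x) a2 can be taken to be 0.

    Two things remain, because the connection and the curvature are only given
    on globally defined smooth fields.

    First, there must be enough such fields: through every point there have to
    be m global smooth fields independent at that point.  Instead of bump
    functions, the contact condition provides them.  The volume form
    a1 ^ (d a1)^p ^ a2 ^ (d a2)^q is nonzero at the point on some m smooth
    fields, and, being tensorial and alternating, it vanishes on fields whose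
    values are dependent ([wedge_row_free], [contact_pair_frame]).

    Second, l = Ric(Z1, Z1) must be a smooth function, although Ric is a trace
    computed point by point.  Let E_i be the fields above and D the Gram
    determinant det g(E_i, E_j).  Cramer's rule, multiplied once more by D so
    that it also holds where D vanishes, writes D ^ 2 Z as a combination of the
    E_i with smooth coefficients that are defined on all of M.  The curvature
    is linear over smooth functions in its first argument, so D ^ 2 Ric(X, Y)
    is a polynomial expression in smooth functions ([ricci_frame]), and one can
    divide by D ^ 2 near the point ([smooth_ricci]). *)

Set Implicit Arguments.
Unset Strict Implicit.
Unset Printing Implicit Defensive.

Import Order.TTheory GRing.Theory Num.Theory numFieldNormedType.Exports.
Local Open Scope classical_set_scope.
Local Open Scope ring_scope.

Local Notation coord := Defs.coord.
Local Notation point := Defs.point.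
Local Notation form := Defs.form.

(** * Functions of class C^k on open subsets of normed spaces *)

Section CkGeneral.
Variables (R : realType) (V W : normedModType R).
Implicit Types (f g : V -> W) (U : set V).

Lemma near_eq_differentiable f g (x : V) :
  (\near x, f x = g x) -> differentiable f x -> differentiable g x.
Proof.
move=> fg df; have [dfc dfx] := (diff_locallyP x f).1 df.
have gfx : g \o shift x = cst (g x) + 'd f x +o_ (0 : V) id.
  apply/eqaddoP => _/posnumP[e].
  move/eqaddoP : (dfx) => /(_ e%:num (ltac:(by []))) dfe.
  have fg0 := (nbhs0P (fun y => f y = g y) x).1 fg.
  apply: filterS2 fg0 dfe => h; rewrite -(nbhs_singleton fg) !fctE /=.
  by rewrite /shift/= [h + x]addrC => ->.
have dgf : 'd g x = 'd f x :> (V -> W) by apply: diff_unique gfx.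
by apply/diff_locallyP; split; rewrite dgf.
Qed.

(** Each directional derivative depends only on the germ, and the germs of [f]
    and [g] agree at all points near [u], not just at [u]; this is what the
    induction needs. *)
Lemma Ck_germ k f g (u : V) :
  (\near u, f u = g u) -> Ck k [set u] f -> Ck k [set u] g.
Proof.
elim: k f g => [|k IHk] f g fg /=.
  move=> fc _ -> P; rewrite -(nbhs_singleton fg) => /(fc _ erefl) fP.
  by apply: filterS2 fg fP => v /= ->.
move=> [df Df]; split=> [_ ->|v]; first exact: near_eq_differentiable (df _ _).
apply: IHk (Df v); apply: filterS (near_join fg) => y.
exact: near_eq_derive.
Qed.

Lemma Ck_pointwise k U f :
  Ck k U f <-> forall u, U u -> Ck k [set u] f.
Proof.
elim: k f => [|k IHk] f /=; first by split=> [fc u Uu _ ->|fc u /fc]; auto.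
split=> [[df Df] u Uu|H].
  by split=> [_ ->|v]; [exact: df|move/IHk: (Df v); apply].
split=> [u /H[df _]|v]; first exact: df.
by apply/IHk => u /H[_].
Qed.

(** The model [g] may depend on the point, which is what makes quotients by
    functions that vanish elsewhere accessible. *)
Lemma Ck_local k U f :
  (forall u, U u -> exists2 g, \near u, g u = f u & Ck k [set u] g) ->
  Ck k U f.
Proof.
by move=> H; apply/Ck_pointwise => u /H[g gf /(Ck_germ gf)].
Qed.

Lemma CkW k U f : Ck k.+1 U f -> Ck k U f.
Proof.
elim: k f => [|k IHk] f [df Df] /=.
  by move=> u /df; exact: differentiable_continuous.
by split=> // v; apply: IHk.
Qed.

Lemma Ck_cst k U (a : W) : Ck k U (cst a).
Proof.
elim: k a => [|k IHk] a /=; first by move=> u _; exact: cst_continuous.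
split=> [u _|v]; first exact: differentiable_cst.
have -> : 'D_v (cst a) = cst 0 :> (V -> W).
  by apply/funext => u; rewrite derive_cst.
exact: IHk.
Qed.

Section OnOpen.
Variables (U : set V) (Uo : open U).

Lemma Ck_ext k f g : {in U, f =1 g} -> Ck k U f -> Ck k U g.
Proof.
move=> fg /Ck_pointwise Uf; apply: Ck_local => u Uu; exists f; last exact: Uf.
have := open_nbhs_nbhs (conj Uo Uu); apply: filterS => v Uv.
by apply: fg; rewrite inE.
Qed.

Lemma CkD k f g : Ck k U f -> Ck k U g -> Ck k U (f \+ g).
Proof.
elim: k f g => [|k IHk] f g /=.
  by move=> fc gc u Uu; apply: continuousD; [exact: fc|exact: gc].
move=> [df Df] [dg Dg]; split=> [u Uu|v].
  by apply: differentiableD; [exact: df|exact: dg].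
apply: (@Ck_ext _ ('D_v f \+ 'D_v g)); last exact: IHk.
move=> u; rewrite inE => Uu; rewrite deriveD //; apply: diff_derivable.
  exact: df.
exact: dg.
Qed.

Lemma Ck_sum k (I : Type) (r : seq I) (f : I -> V -> W) :
  (forall i, Ck k U (f i)) -> Ck k U (fun u => \sum_(i <- r) f i u).
Proof.
move=> fk; elim: r => [|i r IHr].
  by under eq_fun do rewrite big_nil; exact: Ck_cst.
by under eq_fun do rewrite big_cons; exact: CkD.
Qed.

Lemma CkZl k (f : V -> R) (a : W) : Ck k U f -> Ck k U (fun u => f u *: a).
Proof.
elim: k f => [|k IHk] f /=.
  by move=> fc u Uu; apply: continuousZl; exact: fc.
move=> [df Df]; split=> [u Uu|v]; first exact: differentiableZl (df u Uu).
apply: Ck_ext (IHk _ (Df v)) => u; rewrite inE => Uu.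
rewrite !deriveE ?diffZl //; try exact: df.
exact: differentiableZl (df u Uu).
Qed.

End OnOpen.
End CkGeneral.

Section CkScalar.
Variables (R : realType) (V : normedModType R) (U : set V) (Uo : open U).
Implicit Types f g : V -> R.

Lemma CkM k f g : Ck k U f -> Ck k U g -> Ck k U (f \* g).
Proof.
elim: k f g => [|k IHk] f g.
  by move=> fc gc u Uu; apply: continuousM; [exact: fc|exact: gc].
move=> fk gk; have [df Df] := fk; have [dg Dg] := gk.
split=> [u Uu|v].
  by apply: differentiableM; [exact: df|exact: dg].
apply: (@Ck_ext _ _ _ _ Uo _ ((f \* 'D_v g) \+ (g \* 'D_v f))).
  move=> u; rewrite inE => Uu; rewrite deriveM //; apply: diff_derivable.
    exact: df.
  exact: dg.
by apply: (CkD Uo); apply: IHk; [exact: CkW|exact: Dg|exact: CkW|exact: Df].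
Qed.

Lemma CkV k f : (forall u, U u -> f u != 0) -> Ck k U f ->
  Ck k U (fun u => (f u)^-1).
Proof.
move=> fn0; elim: k => [|k IHk].
  by move=> fc u Uu; apply: continuousV; [exact: fn0|exact: fc].
move=> fk; have [df Df] := fk; have fVk := IHk (CkW fk).
split=> [u Uu|v]; first by apply: differentiableV; [exact: df|exact: fn0].
pose h u := (f u)^-1.
apply: (@Ck_ext _ _ _ _ Uo _ (cst (-1) \* (h \* h) \* 'D_v f)).
  move=> u; rewrite inE => Uu; rewrite deriveV; [|exact: fn0|].
    by rewrite /= mulN1r /h -invfM -expr2.
  exact/diff_derivable/df.
by apply: CkM (Df v); apply: CkM; [exact: Ck_cst|exact: CkM].
Qed.

Lemma Ck_mxP k (a b : nat) (f : V -> 'M[R]_(a, b)) :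
  Ck k U f <-> forall i j, Ck k U (fun u => f u i j).
Proof.
split=> [fk i j|fk].
  elim: k f fk => [|k IHk] f /=.
    move=> fc u Uu; apply: (@continuous_comp _ _ _ f (fun A : 'M[R]_(a, b) => A i j)).
      exact: fc.
    exact: coord_continuous.
  move=> [df Df]; split=> [u Uu|v].
    apply: (@differentiable_comp _ _ _ _ f (fun A : 'M[R]_(a, b) => A i j)).
      exact: df.
    exact: differentiable_coord.
  apply: Ck_ext (IHk _ (Df v)) => // u; rewrite inE => Uu.
  by rewrite derive_mx ?mxE //; exact/diff_derivable/df.
apply: (@Ck_ext _ _ _ _ Uo _
  (fun u => \sum_(i < a) \sum_(j < b) f u i j *: delta_mx i j)).
  by move=> u _; rewrite -matrix_sum_delta.
by do 2![apply: Ck_sum => // ?]; exact: CkZl.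
Qed.

Lemma Ck_mulmx k (a b c : nat) (f : V -> 'M[R]_(a, b)) (g : V -> 'M[R]_(b, c)) :
  Ck k U f -> Ck k U g -> Ck k U (fun u => f u *m g u).
Proof.
move=> /Ck_mxP fk /Ck_mxP gk; apply/Ck_mxP => i j.
by under eq_fun do rewrite mxE; apply: Ck_sum => // l; exact: CkM.
Qed.

Lemma Ck_trmx k (a b : nat) (f : V -> 'M[R]_(a, b)) :
  Ck k U f -> Ck k U (fun u => (f u)^T).
Proof.
by move=> /Ck_mxP fk; apply/Ck_mxP => i j; under eq_fun do rewrite mxE.
Qed.

End CkScalar.

Lemma derive_comp (R : realType) (U V W : normedModType R) (F : U -> V)
    (G : V -> W) (u v : U) : differentiable F u -> differentiable G (F u) ->
  'D_v (G \o F) u = 'D_('D_v F u) G (F u).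
Proof.
move=> dF dG; have dGF := differentiable_comp dF dG.
by rewrite (deriveE v dGF) (deriveE _ dG) (deriveE v dF) (diff_comp dF dG).
Qed.

(** * Changes of charts and smooth tensor fields *)

Section ChangeOfCharts.
Variables (R : realType) (m : nat) (M : smooth_manifold R m).
Implicit Types (c : chart R m M) (x : M) (u : 'rV[R]_m).

Lemma point_dom c u : (coord c @` dom c) u -> dom c (point c u).
Proof. by move=> [x xc <-]; rewrite coordK. Qed.

Lemma pointK c u : (coord c @` dom c) u -> coord c (point c u) = u.
Proof. by move=> [x xc <-]; rewrite coordK. Qed.

Lemma jacobian_near_id (F : 'rV[R]_m -> 'rV[R]_m) u :
  (\near u, F u = u) -> jacobian F u = 1%:M.
Proof.
move=> Fid; have dF : differentiable F u.
  apply: (@near_eq_differentiable _ _ _ id); last exact: ex_diff.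
  by apply: filterS Fid.
apply/row_matrixP => i; rewrite !rowE mulmx1 -deriveEjacobian //.
by rewrite (near_eq_derive _ Fid) derive_id.
Qed.

Lemma jacobian_comp (F G : 'rV[R]_m -> 'rV[R]_m) u :
  differentiable F u -> differentiable G (F u) ->
  jacobian F u *m jacobian G (F u) = jacobian (G \o F) u.
Proof.
move=> dF dG; apply/row_matrixP => i.
have dGF := differentiable_comp dF dG.
rewrite rowE [RHS]rowE; move: (delta_mx 0 i) => v.
have e1 := deriveEjacobian v dF; have e3 := deriveEjacobian v dGF.
have e2 := deriveEjacobian (v *m jacobian F u) dG.
apply: etrans (mulmxA _ _ _) _; apply: etrans (esym e2) _; apply: etrans _ e3.
by rewrite -e1; apply/esym/derive_comp.
Qed.

Lemma differentiable_transition c c' x : atlas c -> atlas c' ->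
  dom c x -> dom c' x -> differentiable (coord c' \o point c) (coord c x).
Proof.
move=> ac ac' xc xc'; have [] := transition_smooth ac ac' 1%N => /(_ (coord c x)).
by move=> + _; apply; exists x.
Qed.

Lemma near_chart c x : dom c x -> \forall u \near coord c x, (coord c @` dom c) u.
Proof. by move=> xc; apply: open_nbhs_nbhs; split; [exact: img_open|exists x]. Qed.

Lemma transition_self c x : dom c x -> transition c c x = 1%:M.
Proof.
move=> xc; apply: jacobian_near_id; apply: filterS (near_chart xc) => u.
exact: pointK.
Qed.

(** Chain rule for two changes of charts that are inverse to each other near
    [x]. *)
Lemma transition_inv c c' x : atlas c -> atlas c' -> dom c x -> dom c' x ->
  transition c c' x *m transition c' c x = 1%:M.
Proof.
move=> ac ac' xc xc'; have Fx : (coord c' \o point c) (coord c x) = coord c' x.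
  by rewrite /= coordK.
rewrite /transition -Fx jacobian_comp ?Fx; try exact: differentiable_transition.
apply: jacobian_near_id.
have xc'n : \forall u \near coord c x, dom c' (point c u).
  apply: (point_continuous (c := c)); first by exists x.
  by rewrite coordK //; apply: open_nbhs_nbhs; split=> //; exact: dom_open.
apply: filterS2 (near_chart xc) xc'n => u uc uc'.
by rewrite /= coordK ?pointK.
Qed.

End ChangeOfCharts.

Section SmoothFields.
Variables (R : realType) (m : nat) (M : smooth_manifold R m).
Implicit Types (c : chart R m M) (x : M) (u : 'rV[R]_m) (f : M -> R).
Implicit Types (X Y : vfield M) (a : covfield M) (g : bilfield M).

Lemma vfield_rep_chart_at X x :
  vfield_rep (chart_at x) X (coord (chart_at x) x) = X x.
Proof.
have xc := chart_at_dom x.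
by rewrite /vfield_rep coordK // transition_self // mulmx1.
Qed.

Lemma pair1_rep c a Y u : atlas c -> (coord c @` dom c) u ->
  pair1 a Y (point c u) = (vfield_rep c Y u *m covfield_rep c a u) 0 0.
Proof.
move=> ac uc; have yc := point_dom uc.
rewrite /pair1 /vfield_rep /covfield_rep /= mulmxA -(mulmxA (Y _)).
by rewrite transition_inv ?mulmx1 //; [exact: chart_at_atlas|exact: chart_at_dom].
Qed.

Lemma bilinear_change_of_basis n (P Q B : 'M[R]_n) (v w : 'rV[R]_n) :
  P *m Q = 1%:M -> v *m P *m (Q *m B *m Q^T) *m (w *m P)^T = v *m B *m w^T.
Proof.
move=> PQ; rewrite trmx_mul -!mulmxA (mulmxA Q^T) -trmx_mul PQ trmx1 mul1mx.
by rewrite (mulmxA P) PQ mul1mx.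
Qed.

Lemma pair2_rep c g X Y u : atlas c -> (coord c @` dom c) u ->
  pair2 g X Y (point c u) =
  (vfield_rep c X u *m bilfield_rep c g u *m (vfield_rep c Y u)^T) 0 0.
Proof.
move=> ac uc; have yc := point_dom uc.
rewrite /pair2 /vfield_rep /bilfield_rep bilinear_change_of_basis //.
by apply: transition_inv => //; [exact: chart_at_atlas|exact: chart_at_dom].
Qed.

Lemma smooth_pair2 g X Y : smooth_bilfield g -> smooth_vfield X ->
  smooth_vfield Y -> smooth_fun (pair2 g X Y).
Proof.
move=> gs Xs Ys c ac k; have Uo := @img_open _ _ _ c.
apply: (@Ck_ext _ _ _ _ Uo _ (fun u =>
  (vfield_rep c X u *m bilfield_rep c g u *m (vfield_rep c Y u)^T) 0 0)).
  by move=> u; rewrite inE => uc; rewrite -pair2_rep.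
apply: (Ck_mxP Uo k (fun u => vfield_rep c X u *m bilfield_rep c g u *m
  (vfield_rep c Y u)^T)).1.
apply: (Ck_mulmx Uo); last by apply: (Ck_trmx Uo); exact: Ys.
by apply: (Ck_mulmx Uo); [exact: Xs|exact: gs].
Qed.

Lemma smooth_fun_cst (k : R) : smooth_fun (cst k : M -> R).
Proof. by move=> c ac n; exact: Ck_cst. Qed.

Lemma smooth_funD f f' : smooth_fun f -> smooth_fun f' ->
  smooth_fun (fun x => f x + f' x).
Proof.
move=> fs fs' c ac k; apply: (CkD (@img_open _ _ _ c)); [exact: fs|exact: fs'].
Qed.

Lemma smooth_funM f f' : smooth_fun f -> smooth_fun f' ->
  smooth_fun (fun x => f x * f' x).
Proof.
move=> fs fs' c ac k; apply: (CkM (@img_open _ _ _ c)); [exact: fs|exact: fs'].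
Qed.

Lemma smooth_fun_sum (I : Type) (r : seq I) (F : I -> M -> R) :
  (forall i, smooth_fun (F i)) -> smooth_fun (fun x => \sum_(i <- r) F i x).
Proof.
move=> Fs; elim: r => [|i r IHr].
  by under eq_fun do rewrite big_nil; exact: smooth_fun_cst.
by under eq_fun do rewrite big_cons; exact: smooth_funD.
Qed.

Lemma smooth_fun_prod (I : Type) (r : seq I) (F : I -> M -> R) :
  (forall i, smooth_fun (F i)) -> smooth_fun (fun x => \prod_(i <- r) F i x).
Proof.
move=> Fs; elim: r => [|i r IHr].
  by under eq_fun do rewrite big_nil; exact: smooth_fun_cst.
by under eq_fun do rewrite big_cons; exact: smooth_funM.
Qed.

Lemma smooth_fun_det n (F : M -> 'M[R]_n) :
  (forall i j, smooth_fun (fun x => F x i j)) -> smooth_fun (fun x => \det (F x)).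
Proof.
move=> Fs; apply: smooth_fun_sum => s; apply: smooth_funM.
  exact: smooth_fun_cst.
by apply: smooth_fun_prod => i.
Qed.

Lemma smooth_fun_adj n (F : M -> 'M[R]_n) :
  (forall i j, smooth_fun (fun x => F x i j)) ->
  forall i j, smooth_fun (fun x => (\adj (F x)) i j).
Proof.
move=> Fs i j; under eq_fun do rewrite mxE /cofactor.
apply: smooth_funM; first exact: smooth_fun_cst.
by apply: smooth_fun_det => a b; under eq_fun do rewrite !mxE; exact: Fs.
Qed.

(** This avoids naming a neighbourhood: the equation is global, and [D] may
    vanish away from [x]. *)
Lemma smooth_fun_quotient f :
  (forall x, exists D h, [/\ smooth_fun D, smooth_fun h, D x != 0 &
     forall y, D y * f y = h y]) -> smooth_fun f.
Proof.
move=> fq c ac k; apply: Ck_local => u uc.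
have [D [h [Ds hs Dx Dfh]]] := fq (point c u).
pose U := interior ((coord c @` dom c) `&` [set v | D (point c v) != 0]).
have Uu : U u.
  apply: filterI; first by apply: open_nbhs_nbhs; split=> //; exact: img_open.
  have Dc : {for u, continuous (D \o point c)} := Ds c ac 0%N u uc.
  apply: (Dc [set r | r != 0]).
  by apply: open_nbhs_nbhs; split=> //; exact: open_neq.
have Usub : U `<=` coord c @` dom c by move=> v /interior_subset[].
have UC F : smooth_fun F -> Ck k U (F \o point c).
  by move=> Fs; apply/Ck_pointwise => v /Usub; apply: (Ck_pointwise k _ _).1; exact: Fs.
exists (fun v => h (point c v) * (D (point c v))^-1).
  have : nbhs u U by apply: open_nbhs_nbhs; split=> //; exact: open_interior.
  apply: filterS => v /interior_subset[_ Dv].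
  by rewrite -Dfh mulrC mulKf.
apply: (Ck_pointwise k U _).1 Uu.
apply: (CkM (@open_interior _ _)); first exact: UC.
by apply: (CkV (@open_interior _ _)) (UC _ Ds) => v /interior_subset[].
Qed.

Lemma smooth_vadd X Y : smooth_vfield X -> smooth_vfield Y ->
  smooth_vfield (vadd X Y).
Proof.
move=> Xs Ys c ac k.
have -> : vfield_rep c (vadd X Y) = vfield_rep c X \+ vfield_rep c Y.
  by apply/funext => u; rewrite /vfield_rep /= mulmxDl.
by apply: (CkD (@img_open _ _ _ c)); [exact: Xs|exact: Ys].
Qed.

Lemma smooth_vscale f X : smooth_fun f -> smooth_vfield X ->
  smooth_vfield (vscale f X).
Proof.
move=> fs Xs c ac k; have Uo := @img_open _ _ _ c; apply/(Ck_mxP Uo) => i j.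
have -> : (fun u => vfield_rep c (vscale f X) u i j) =
    (f \o point c) \* (fun u => vfield_rep c X u i j).
  by apply/funext => u; rewrite /vfield_rep /= -scalemxAl mxE.
by apply: (CkM Uo); [exact: fs|apply: (Ck_mxP Uo k _).1; exact: Xs].
Qed.

Lemma smooth_vfield0 : smooth_vfield (M := M) (fun=> 0).
Proof.
move=> c ac k; have -> : vfield_rep (M := M) c (fun=> 0) = cst 0; last exact: Ck_cst.
by apply/funext => u; rewrite /vfield_rep /= mul0mx.
Qed.

Lemma smooth_vsum (I : Type) (r : seq I) (F : I -> vfield M) :
  (forall i, smooth_vfield (F i)) ->
  smooth_vfield (fun x => \sum_(i <- r) F i x).
Proof.
move=> Fs; elim: r => [|i r IHr].
  by under eq_fun do rewrite big_nil; exact: smooth_vfield0.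
by under eq_fun do rewrite big_cons; exact: smooth_vadd.
Qed.

End SmoothFields.

Lemma derive_mulmx (R : realType) (V : normedModType R) (a b d : nat)
    (f : V -> 'M[R]_(a, b)) (h : V -> 'M[R]_(b, d)) (u v : V) :
  derivable f u v -> derivable h u v ->
  'D_v (fun w => f w *m h w) u = 'D_v f u *m h u + f u *m 'D_v h u.
Proof.
move=> df dh; have dfE := (derivable_mxP f u v).1 df.
have dhE := (derivable_mxP h u v).1 dh.
have dM i j k : derivable ((fun w => f w i k) * (fun w => h w k j)) u v.
  exact: derivableM.
have fhE i j : (fun w => (f w *m h w) i j) =
    \sum_(k < b) ((fun w => f w i k) * (fun w => h w k j)).
  by apply/funext => w; rewrite mxE fct_sumE.
rewrite derive_mx; last first.
  by apply/derivable_mxP => i j; rewrite fhE; exact: derivable_sum.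
apply/matrixP => i j; rewrite !mxE fhE derive_sum // -big_split /=.
apply: eq_bigr => k _; rewrite deriveM // (derive_mx df) (derive_mx dh) !mxE.
by rewrite addrC; congr (_ + _); rewrite /GRing.scale /= mulrC.
Qed.

(** * The contact volume form and global fields spanning a tangent space *)

Section ContactVolume.
Variables (R : realType) (m : nat) (M : smooth_manifold R m).
Implicit Types (x : M) (X Y : vfield M) (a : covfield M).

Lemma vact_pair1 a X Y x : smooth_covfield a -> smooth_vfield Y ->
  let c := chart_at x in
  vact X (pair1 a Y) x =
  ('D_(X x) (vfield_rep c Y) (coord c x) *m a x) 0 0 +
  (Y x *m 'D_(X x) (covfield_rep c a) (coord c x)) 0 0.
Proof.
move=> sa sY c; have ac : atlas c := chart_at_atlas x.
have xc : dom c x := chart_at_dom x.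
have uc : (coord c @` dom c) (coord c x) by exists x.
have dY := (sY c ac 1%N).1 _ uc; have da := (sa c ac 1%N).1 _ uc.
have dYx : derivable _ _ (X x) := diff_derivable dY.
have dax : derivable _ _ (X x) := diff_derivable da.
rewrite /vact -/c; transitivity ('D_(X x)
    (fun u => (vfield_rep c Y u *m covfield_rep c a u) 0 0) (coord c x)).
  apply: near_eq_derive; apply: filterS (near_chart xc) => u.
  exact: pair1_rep.
have dm : derivable (fun u => vfield_rep c Y u *m covfield_rep c a u)
    (coord c x) (X x).
  apply: diff_derivable.
  have Uo := @img_open _ _ _ c.
  have := Ck_mulmx Uo (sY c ac 1%N) (sa c ac 1%N).
  by move=> [+ _]; apply.
have := derive_mulmx dYx dax; rewrite derive_mx // => /matrixP/(_ 0 0).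
rewrite [LHS]mxE [RHS]mxE => ->.
have -> : covfield_rep c a (coord c x) = a x.
  by rewrite /covfield_rep coordK // transition_self // mul1mx.
by rewrite vfield_rep_chart_at.
Qed.

(** The derivatives of the components of [X] and [Y] cancel between the first
    two terms of the exterior derivative and the bracket; what is left only
    differentiates [a]. *)
Lemma ext_d_tensorial a x : smooth_covfield a -> exists E : 'M[R]_m,
  forall X Y, smooth_vfield X -> smooth_vfield Y ->
  ext_d a X Y x = (X x *m E *m (Y x)^T) 0 0.
Proof.
move=> sa; set c := chart_at x.
have uc : (coord c @` dom c) (coord c x).
  by exists x => //; exact: chart_at_dom.
have da := (sa c (chart_at_atlas x) 1%N).1 _ uc.
pose L : 'M[R]_m := \matrix_(i, j) 'D_(delta_mx 0 i) (covfield_rep c a) (coord c x) j 0.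
have DaE (v : 'rV[R]_m) : 'D_v (covfield_rep c a) (coord c x) = (v *m L)^T.
  rewrite {1}(row_sum_delta v) (deriveE _ da) linear_sum.
  apply/matrixP => j k; rewrite ord1 summxE !mxE; apply: eq_bigr => i _.
  by rewrite linearZ !mxE (deriveE _ da).
exists (2^-1 *: (L - L^T)) => X Y sX sY.
have tr11 (A : 'M[R]_1) : A 0 0 = A^T 0 0 by rewrite mxE.
rewrite /ext_d !vact_pair1 // -/c !DaE /pair1 /bracket -/c.
rewrite mulmxBl.
have -> : (Y x *m (X x *m L)^T) 0 0 = (X x *m L *m (Y x)^T) 0 0.
  by rewrite tr11 trmx_mul trmxK.
have -> : (X x *m (Y x *m L)^T) 0 0 = (X x *m L^T *m (Y x)^T) 0 0.
  by rewrite trmx_mul mulmxA.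
rewrite -scalemxAr -scalemxAl mulmxBr mulmxBl [RHS]mxE; congr (_ * _).
have subE (A B : 'M[R]_1) : (A - B) 0 0 = A 0 0 - B 0 0 by rewrite !mxE.
have cancel (b d e h : R) : b + d - (e + h) - (b - e) = d - h by ring.
by rewrite !subE cancel.
Qed.

(** Multilinearity at [x], as a sum of monomials in the components of the
    arguments.  The index set is an arbitrary finite type, so that a wedge
    product only enlarges it. *)
Definition tensorial_at k (w : form M k) x : Prop :=
  exists (I : finType) (t : I -> R) (f : I -> 'I_k -> 'I_m),
  forall X : 'I_k -> vfield M, (forall i, smooth_vfield (X i)) ->
  w X x = \sum_i t i * \prod_j X j x 0 (f i j).

Lemma form_of_covfield_tensorial a x : tensorial_at (form_of_covfield a) x.
Proof.
exists 'I_m, (fun i => a x i 0), (fun i _ => i) => X _.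
rewrite /form_of_covfield /pair1 mxE; apply: eq_bigr => i _.
by rewrite big_ord1 mulrC.
Qed.

Lemma form_d_tensorial a x : smooth_covfield a -> tensorial_at (form_d a) x.
Proof.
move=> sa; have [E EE] := ext_d_tensorial x sa.
exists ('I_m * 'I_m)%type, (fun ij => E ij.1 ij.2),
  (fun ij k => if k == ord0 then ij.1 else ij.2) => X sX.
rewrite /form_d EE // mxE; under eq_bigr do rewrite mxE mulr_suml.
rewrite exchange_big pair_big; apply: eq_bigr => -[i j] _ /=.
rewrite big_ord_recl big_ord1 /= [(X ord_max x)^T _ _]mxE.
have -> : lift ord0 ord0 = ord_max :> 'I_2 by apply/val_inj.
by rewrite mulrAC mulrC.
Qed.

(** Alternating a product of components over all permutations of the
    arguments gives a determinant, by the Leibniz formula. *)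
Lemma wedge_det k l (w : form M k) (w' : form M l) x :
  tensorial_at w x -> tensorial_at w' x ->
  exists (I : finType) (t : I -> R) (f : I -> 'I_(k + l) -> 'I_m),
  forall X : 'I_(k + l) -> vfield M, (forall i, smooth_vfield (X i)) ->
  wedge w w' X x = \sum_i t i * \det (\matrix_(b, a) X a x 0 (f i b)).
Proof.
move=> [I [t [f tE]]] [I' [t' [f' t'E]]].
exists (I * I')%type, (fun i => (k + l)`!%:R^-1 * (t i.1 * t' i.2)),
  (fun i b => match fintype.split b with inl j => f i.1 j | inr j => f' i.2 j end).
move=> X sX; rewrite /wedge.
under [RHS]eq_bigr do rewrite -mulrA; rewrite -mulr_sumr; congr (_ * _).
under [LHS]eq_bigr => s _.
  rewrite tE // t'E // -mulrA mulr_suml.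
  under eq_bigr do rewrite mulr_sumr.
  rewrite pair_big mulr_sumr; over.
rewrite exchange_big; apply: eq_bigr => -[i i'] _ /=.
rewrite mulr_sumr; apply: eq_bigr => s _.
rewrite big_split_ord /= [RHS]mulrCA; congr (_ * _).
rewrite mulrACA; congr (_ * (_ * _)).
  by apply: eq_bigr => j _; rewrite mxE (unsplitK (inl _)).
by apply: eq_bigr => j _; rewrite mxE (unsplitK (inr _)).
Qed.

Lemma wedge_tensorial k l (w : form M k) (w' : form M l) x :
  tensorial_at w x -> tensorial_at w' x -> tensorial_at (wedge w w') x.
Proof.
move=> tw tw'; have [I [t [f wE]]] := wedge_det tw tw'.
exists (I * 'S_(k + l))%type, (fun i : I * 'S_(k + l) =>
    t i.1 * (-1) ^+ i.2),
  (fun (i : I * 'S_(k + l)) j => f i.1 ((i.2^-1)%g j)) => X sX.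
rewrite wE // -(pair_big xpredT xpredT (fun i (s : 'S_(k + l)) => t i * (-1) ^+ s *
  \prod_j X j x 0 (f i ((s^-1)%g j)))) /=.
apply: eq_bigr => i _; rewrite mulr_sumr; apply: eq_bigr => s _.
rewrite -mulrA [in RHS](reindex_inj (@perm_inj _ s)); congr (_ * (_ * _)).
by apply: eq_bigr => b _; rewrite mxE [in RHS]permK.
Qed.

Lemma wedge_pow_tensorial k (w : form M k) n x :
  tensorial_at w x -> tensorial_at (@wedge_pow _ _ _ k w n) x.
Proof.
move=> tw; elim: n => [|n IHn] /=; last exact: wedge_tensorial.
exists unit, (fun=> 1), (fun _ (i : 'I_0) => False_rect 'I_m (notF (ltn_ord i))) => X _.
by rewrite big_const card_unit /= big_ord0 mulr1 addr0.
Qed.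

(** Each determinant of [wedge_det] is that of a product of the matrix of the
    values of the fields with a selection of columns; its being nonzero bounds
    the rank from below. *)
Lemma wedge_row_free k l (w : form M k) (w' : form M l) x
    (X : 'I_(k + l) -> vfield M) :
  tensorial_at w x -> tensorial_at w' x -> (forall i, smooth_vfield (X i)) ->
  wedge w w' X x != 0 -> row_free (\matrix_i X i x).
Proof.
move=> tw tw' sX; have [I [t [f ->]]] // := wedge_det tw tw'.
case: (pickP (fun i => \det (\matrix_(b, a) X a x 0 (f i b)) != 0)).
  move=> i det_neq0 _; set V := \matrix_i _.
  set A := \matrix_(b, a) _ in det_neq0.
  have rankA : \rank A = (k + l)%N.
    by apply/eqP; rewrite -[_ == _]/(row_free A) row_free_unit unitmxE unitfE.
  have AV : A = (V *m \matrix_(j, b) (j == f i b)%:R)^T.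
    apply/matrixP => b a; rewrite !mxE (bigD1 (f i b)) //= big1.
      by rewrite !mxE eqxx mulr1 addr0.
    by move=> j /negPf jf; rewrite !mxE jf mulr0.
  rewrite /row_free eqn_leq rank_leq_row /=.
  by apply: leq_trans (eq_leq (esym rankA)) _; rewrite AV mxrank_tr mxrankM_maxl.
move=> det0; rewrite big1 ?eqxx // => i _.
by have /negbFE/eqP -> := det0 i; rewrite mulr0.
Qed.

Definition frame_at (X : 'I_m -> vfield M) x : Prop :=
  (forall i, smooth_vfield (X i)) /\ \matrix_i X i x \in unitmx.

(** The degree of the volume form is the dimension, so the fields on which it
    does not vanish form a basis. *)
Lemma contact_pair_frame p q (a1 a2 : covfield M) x :
  contact_pair p q a1 a2 -> exists E, frame_at E x.
Proof.
move=> [_ dimM [sa1 sa2] /(_ x) [X sX wX] _ _].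
have := wedge_row_free (form_of_covfield_tensorial a1 x)
  (wedge_tensorial (wedge_pow_tensorial p (form_d_tensorial x sa1))
    (wedge_tensorial (form_of_covfield_tensorial a2 x)
      (wedge_pow_tensorial q (form_d_tensorial x sa2)))) sX wX.
have : m = (1 + (p * 2 + (1 + q * 2)))%N by rewrite dimM; lia.
move: X sX {wX}; set n := (1 + _)%N; move: n => n X sX mn freeX.
exists (fun i => X (cast_ord mn i)); split=> [i|]; first exact: sX.
rewrite -row_free_unit; apply/row_freeP; have [B XB] := row_freeP freeX.
exists (\matrix_(j, i) B j (cast_ord mn i)).
apply/matrixP => i j; have /matrixP/(_ (cast_ord mn i) (cast_ord mn j)) := XB.
rewrite !mxE (inj_eq (@cast_ord_inj _ _ mn)) => <-.
by apply: eq_bigr => l _; rewrite !mxE.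
Qed.

End ContactVolume.

(** * Functions of two arguments with proportional 2x2 minors *)

Section KulkarniNomizu.
Variables (F : fieldType) (T : Type) (P : T -> Prop).
Variables (S G : T -> T -> F) (k : F) (e d : 'I_3 -> T).
Hypotheses (k_neq0 : k != 0) (Pe : forall i, P (e i)) (Pd : forall i, P (d i)).
Hypothesis dual : forall i j, G (e i) (d j) = (i == j)%:R.
Hypothesis SG : forall X1 X2 X3 X4, P X1 -> P X2 -> P X3 -> P X4 ->
  S X2 X3 * S X1 X4 - S X1 X3 * S X2 X4 =
  k * (G X2 X3 * G X1 X4 - G X1 X3 * G X2 X4).

Lemma third_index (i j : 'I_3) : exists l, (l != i) && (l != j).
Proof.
case: i j => [[|[|[|//]]] ?] [[|[|[|//]]] ?];
  by [exists ord0 | exists (lift ord0 ord0) | exists ord_max].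
Qed.

(** With [l] a third index, consider the 2x3 matrix of rows [i], [l] and
    columns [i], [j], [l].  Columns [i] and [l] are independent, while column
    [j] is parallel to both, hence zero. *)
Lemma minor_offdiag i j : i != j -> S (e i) (d j) = 0.
Proof.
move=> ij; have [l /andP[li lj]] := third_index i j.
have E1 := SG (Pe l) (Pe i) (Pd i) (Pd l).
have E2 := SG (Pe l) (Pe i) (Pd j) (Pd l).
have E3 := SG (Pe l) (Pe i) (Pd i) (Pd j).
move: E1 E2 E3; rewrite !dual !eqxx (negPf ij) (negPf li) (negPf lj).
rewrite !(mulr0, mul0r, subr0, mulr1) => E1 E2 E3.
apply: (mulfI k_neq0); rewrite mulr0 -E1.
have -> : (S (e i) (d i) * S (e l) (d l) - S (e l) (d i) * S (e i) (d l)) * S (e i) (d j) =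
  S (e i) (d i) * (S (e i) (d j) * S (e l) (d l) - S (e l) (d j) * S (e i) (d l)) +
  S (e i) (d l) * (S (e i) (d i) * S (e l) (d j) - S (e l) (d i) * S (e i) (d j)).
  by ring.
by rewrite E2 E3 !mulr0 addr0.
Qed.

Lemma minor_diag i j : i != j -> S (e i) (d i) * S (e j) (d j) = k.
Proof.
move=> ij; have := SG (Pe j) (Pe i) (Pd i) (Pd j).
rewrite !dual !eqxx (negPf ij) eq_sym (negPf ij) (minor_offdiag ij).
by rewrite !(mulr0, subr0, mulr1).
Qed.

(** The minors on [e] and [d] give S(e i, d j) = l delta_ij with l ^ 2 = k, the
    diagonal entries being equal because any two of them multiply to [k]; then
    one, and finally both, of the arguments [e i] and [d i] are exchanged for
    arbitrary ones, each time by expanding a minor that still contains a known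
    diagonal entry [l]. *)
Lemma proportional_of_minors :
  exists l, forall X Y, P X -> P Y -> S X Y = l * G X Y.
Proof.
pose l := S (e ord0) (d ord0).
have diag i : S (e i) (d i) = l.
  have [->//|i0] := eqVneq i ord0.
  have [j /andP[ji j0]] := third_index i ord0.
  have jj0 : S (e j) (d j) != 0.
    apply: contraNneq k_neq0 => jj; rewrite -(minor_diag ji) jj mul0r //.
  by apply: (mulfI jj0); rewrite (minor_diag ji) (minor_diag j0).
have kE : k = l * l.
  have [j /andP[j0 _]] := third_index ord0 ord0.
  by rewrite -(minor_diag j0) !diag.
have l0 : l != 0 by apply: contraNneq k_neq0 => l0; rewrite kE l0 mul0r.
have SeY i Y : P Y -> S (e i) Y = l * G (e i) Y.
  move=> PY; have [j /andP[ji _]] := third_index i i.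
  have ij : i != j by rewrite eq_sym.
  have := SG (Pe j) (Pe i) PY (Pd j).
  rewrite !dual eqxx (negPf ij) (minor_offdiag ij) diag.
  by rewrite !(mulr0, subr0, mulr1) kE => E; apply: (mulfI l0); rewrite mulrC E mulrA.
have SXd i X : P X -> S X (d i) = l * G X (d i).
  move=> PX; have [j /andP[ji _]] := third_index i i.
  have := SG (Pe j) PX (Pd i) (Pd j).
  rewrite !dual eqxx (negPf ji) (minor_offdiag ji) diag.
  by rewrite !(mul0r, subr0, mulr1) kE => E; apply: (mulfI l0); rewrite mulrC E mulrA.
exists l => X Y PX PY; have := SG (Pe ord0) PX PY (Pd ord0).
rewrite diag SeY // SXd // dual eqxx mulr1 kE => E; apply: (mulfI l0).
have -> : l * S X Y = S X Y * l - l * G (e ord0) Y * (l * G X (d ord0)) +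
   l * G (e ord0) Y * (l * G X (d ord0)) by ring.
by rewrite E; ring.
Qed.

End KulkarniNomizu.

(** * Tensoriality of the curvature and smoothness of the Ricci tensor *)

Section Curvature.
Variables (R : realType) (m : nat) (M : smooth_manifold R m).
Variables (g : bilfield M) (nabla : vfield M -> vfield M -> vfield M).
Hypotheses (metric_g : riemannian_metric g) (lc : levi_civita g nabla).
Variable U : vfield M.
Hypotheses (sU : smooth_vfield U) (unitU : forall x, pair2 g U U x = 1).
Implicit Types (X Y Z : vfield M) (f : M -> R).

Let scm (r : R) := @smooth_fun_cst R m M r.

(** By the Leibniz rule, (X f) U is the smooth field
    nabla_X (f U) - f nabla_X U, and X f is its product with the unit field
    [U]. *)
Lemma smooth_vact f X : smooth_fun f -> smooth_vfield X ->
  smooth_fun (vact X f).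
Proof.
move=> sf sX; pose W := vadd (nabla X (vscale f U))
  (vscale (cst (-1)) (vscale f (nabla X U))).
have sW : smooth_vfield W.
  apply: smooth_vadd; first exact: (nabla_smooth lc) (smooth_vscale _ _).
  apply: smooth_vscale; first exact: scm.
  by apply: smooth_vscale => //; exact: nabla_smooth lc _ _ _ _.
have -> : vact X f = pair2 g W U; last exact: smooth_pair2 (metric_smooth _) _ _.
apply/funext => x; rewrite /pair2 /W (nabla_leibniz lc) // /vadd /vscale /=.
rewrite scaleN1r addrK -!scalemxAl mxE -[in RHS]/(pair2 g U U x).
by rewrite unitU mulr1.
Qed.

Lemma smooth_bracket X Y : smooth_vfield X -> smooth_vfield Y ->
  smooth_vfield (bracket X Y).
Proof.
move=> sX sY.
have -> : bracket X Y = vadd (nabla X Y) (vscale (cst (-1)) (nabla Y X)).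
  by apply/funext => x; rewrite -(nabla_torsion_free lc) // /vadd /vscale scaleN1r.
apply: smooth_vadd; first exact: nabla_smooth lc _ _ _ _.
exact: smooth_vscale (scm (-1)) (nabla_smooth lc _ _).
Qed.

(** The torsion vanishes, so this is the Leibniz rule of the connection. *)
Lemma bracket_scalel f X Y : smooth_fun f -> smooth_vfield X ->
  smooth_vfield Y -> bracket (vscale f X) Y =
  vadd (vscale f (bracket X Y)) (vscale (fun x => -1 * vact Y f x) X).
Proof.
move=> sf sX sY; have sfX := smooth_vscale sf sX; apply/funext => x.
rewrite -(nabla_torsion_free lc) // (nabla_scalel lc) // (nabla_leibniz lc) //.
rewrite /vadd /vscale -(nabla_torsion_free lc) // scalerBr mulN1r scaleNr.
by rewrite opprD addrCA addrC.
Qed.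

Lemma bracket_addl X X' Y : smooth_vfield X -> smooth_vfield X' ->
  smooth_vfield Y -> bracket (vadd X X') Y = vadd (bracket X Y) (bracket X' Y).
Proof.
move=> sX sX' sY; have sXX := smooth_vadd sX sX'; apply/funext => x.
rewrite -(nabla_torsion_free lc) // (nabla_addl lc) // (nabla_addr lc) //.
by rewrite /vadd -!(nabla_torsion_free lc) // opprD addrACA.
Qed.

Lemma curvature_addl Z Z' X Y x : smooth_vfield Z -> smooth_vfield Z' ->
  smooth_vfield X -> smooth_vfield Y ->
  curvature nabla (vadd Z Z') X Y x =
  curvature nabla Z X Y x + curvature nabla Z' X Y x.
Proof.
move=> sZ sZ' sX sY; have sn A B := nabla_smooth lc (X := A) (Y := B).
have sXY := sn _ _ sX sY; have sZY := sn _ _ sZ sY; have sZ'Y := sn _ _ sZ' sY.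
have sZX := smooth_bracket sZ sX; have sZ'X := smooth_bracket sZ' sX.
rewrite /curvature bracket_addl // (nabla_addl lc sZ sZ' sXY).
rewrite (nabla_addl lc sZ sZ' sY) (nabla_addr lc sX sZY sZ'Y).
rewrite (nabla_addl lc sZX sZ'X sY) /vadd.
have subACA (v v' w w' : 'rV[R]_m) : v + v' - (w + w') = (v - w) + (v' - w').
  by rewrite opprD addrACA.
by rewrite (subACA (nabla Z _ x)) subACA.
Qed.

(** The terms (X f) nabla_Z Y coming from the Leibniz rule and from the bracket
    cancel. *)
Lemma curvature_scalel f Z X Y x : smooth_fun f -> smooth_vfield Z ->
  smooth_vfield X -> smooth_vfield Y ->
  curvature nabla (vscale f Z) X Y x = f x *: curvature nabla Z X Y x.
Proof.
move=> sf sZ sX sY; have sn A B := nabla_smooth lc (X := A) (Y := B).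
have sXY := sn _ _ sX sY; have sZY := sn _ _ sZ sY.
have sZX := smooth_bracket sZ sX.
have sh : smooth_fun (fun y => -1 * vact X f y).
  by apply: smooth_funM (scm (-1)) _; exact: smooth_vact.
have add := nabla_addl lc (smooth_vscale sf sZX) (smooth_vscale sh sZ) sY.
rewrite /curvature bracket_scalel // add.
rewrite (nabla_scalel lc sf sZ sXY) (nabla_scalel lc sf sZ sY).
rewrite (nabla_scalel lc sf sZX sY) (nabla_scalel lc sh sZ sY).
rewrite (nabla_leibniz lc sf sX sZY) /vadd /vscale mulN1r scaleNr !scalerBr.
have cancel (A B C w : 'rV[R]_m) : A - (w + B) - (C - w) = A - B - C.
  by rewrite opprD opprB !addrA [A - w - B]addrAC subrK.
exact: cancel.
Qed.

Lemma curvature_suml (I : Type) (r : seq I) (F : I -> vfield M) X Y x :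
  (forall i, smooth_vfield (F i)) -> smooth_vfield X -> smooth_vfield Y ->
  curvature nabla (fun y => \sum_(i <- r) F i y) X Y x =
  \sum_(i <- r) curvature nabla (F i) X Y x.
Proof.
move=> sF sX sY; elim: r => [|i r IHr].
  have -> : (fun y => \sum_(i <- [::]) F i y) = vscale (cst 0) U.
    by apply/funext => y; rewrite big_nil /vscale scale0r.
  by rewrite curvature_scalel ?scale0r ?big_nil //; exact: scm.
have -> : (fun y => \sum_(j <- i :: r) F j y) =
    vadd (F i) (fun y => \sum_(j <- r) F j y).
  by apply/funext => y; rewrite big_cons.
by rewrite big_cons -IHr curvature_addl //; exact: smooth_vsum.
Qed.

Lemma metric_unit x : g x \in unitmx.
Proof.
rewrite -row_free_unit -kermx_eq0; apply/rowV0P => v /sub_kermxP vg0.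
apply/eqP/negPn/negP => /(metric_pos metric_g x).
by rewrite vg0 mul0mx mxE ltxx.
Qed.

Lemma smooth_curvature X Y Z : smooth_vfield X -> smooth_vfield Y ->
  smooth_vfield Z -> smooth_vfield (curvature nabla X Y Z).
Proof.
move=> sX sY sZ; have sn A B := nabla_smooth lc A B.
have sN (A : vfield M) : smooth_vfield A -> smooth_vfield (vscale (cst (-1)) A).
  exact: smooth_vscale (scm (-1)).
have -> : curvature nabla X Y Z = vadd (vadd (nabla X (nabla Y Z))
    (vscale (cst (-1)) (nabla Y (nabla X Z))))
    (vscale (cst (-1)) (nabla (bracket X Y) Z)).
  by apply/funext => x; rewrite /curvature /vadd /vscale !scaleN1r.
apply: smooth_vadd; first apply: smooth_vadd.
- exact: sn (sn _ _ _ _).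
- exact: sN (sn _ _ _ (sn _ _ _ _)).
- exact: sN (sn _ _ (smooth_bracket _ _) _).
Qed.

Lemma pair2_mx n n' (A : 'I_n -> vfield M) (B : 'I_n' -> vfield M) x i j :
  (\matrix_k A k x *m g x *m (\matrix_k B k x)^T) i j = pair2 g (A i) (B j) x.
Proof.
rewrite /pair2 !mxE; apply: eq_bigr => k _; rewrite !mxE; congr (_ * _).
by apply: eq_bigr => l _; rewrite mxE.
Qed.

Section Frame.
Variable E : 'I_m -> vfield M.
Hypothesis sE : forall i, smooth_vfield (E i).
Local Notation V := (fun x => \matrix_i E i x : 'M[R]_m).

Let gram x : 'M[R]_m := \matrix_(i, j) pair2 g (E i) (E j) x.

Let gramE x : gram x = V x *m g x *m (V x)^T.
Proof. by apply/matrixP => i j; rewrite mxE pair2_mx. Qed.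

Lemma det_gram_neq0 x : V x \in unitmx -> \det (gram x) != 0.
Proof.
move=> Vu; rewrite gramE !det_mulmx det_tr -unitfE !unitrM.
by rewrite -!unitmxE metric_unit Vu.
Qed.

Lemma gram_neq0_frame x : \det (gram x) != 0 -> V x \in unitmx.
Proof.
rewrite gramE !det_mulmx det_tr => D0.
by rewrite unitmxE unitfE; apply: contraNneq D0 => ->; rewrite !mul0r.
Qed.

Lemma smooth_gram i j : smooth_fun (fun x => gram x i j).
Proof.
under eq_fun do rewrite mxE.
exact: smooth_pair2 (metric_smooth metric_g) (sE i) (sE j).
Qed.

Let D x := \det (gram x).
Let sD : smooth_fun D. Proof. exact: smooth_fun_det smooth_gram. Qed.

(** Where the [E i] are independent, this is [D] times the inverse of the
    matrix of their values, yet it is polynomial in smooth functions. *)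
Let K x := g x *m (V x)^T *m \adj (gram x).

Let K_invmx x : V x \in unitmx -> K x = D x *: invmx (V x).
Proof.
move=> Vu; rewrite -[K x](mulKmx Vu) /K !mulmxA -(mulmxA (invmx _)) -(mulmxA (invmx _)).
by rewrite -gramE -mulmxA mul_mx_adj mul_mx_scalar.
Qed.

Let coef Z i x := D x * \sum_j pair2 g Z (E j) x * (\adj (gram x)) j i.

Let smooth_coef Z i : smooth_vfield Z -> smooth_fun (coef Z i).
Proof.
move=> sZ; apply: smooth_funM => //; apply: smooth_fun_sum => j.
apply: smooth_funM; first exact: smooth_pair2 (metric_smooth _) sZ (sE j).
exact: smooth_fun_adj smooth_gram _ _.
Qed.

Let coefE Z i x : coef Z i x = D x * (Z x *m K x) 0 i.
Proof.
rewrite /coef /K mulmxA mxE; congr (_ * _); apply: eq_bigr => j _.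
congr (_ * _); rewrite -(pair2_mx (fun=> Z) E x (ord0 : 'I_1)) mulmxA.
by congr ((_ *m _ *m _) _ _); apply/rowP => l; rewrite mxE.
Qed.

(** The second factor [D] makes both sides vanish where the [E i] are
    dependent, so that the equality holds between global fields, to which the
    connection can be applied. *)
Let cramer Z : vscale (fun x => D x * D x) Z =
  (fun x => \sum_i vscale (coef Z i) (E i) x).
Proof.
apply/funext => x; rewrite /vscale.
have [D0|D0] := eqVneq (D x) 0.
  rewrite D0 mul0r scale0r big1 // => i _.
  by rewrite coefE D0 mul0r scale0r.
have Vu := gram_neq0_frame D0.
transitivity (D x *: (Z x *m K x *m V x)).
  by rewrite K_invmx // -scalemxAr -scalemxAl scalerA mulmxKV.
rewrite mulmx_sum_row scaler_sumr; apply: eq_bigr => i _.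
by rewrite rowK scalerA coefE.
Qed.

Lemma curvature_frame Z X Y x : smooth_vfield Z -> smooth_vfield X ->
  smooth_vfield Y -> (D x * D x) *: curvature nabla Z X Y x =
  \sum_i coef Z i x *: curvature nabla (E i) X Y x.
Proof.
move=> sZ sX sY.
rewrite -(curvature_scalel _ (smooth_funM sD sD)) // cramer.
rewrite curvature_suml // => [|i]; last by apply: smooth_vscale; first exact: smooth_coef.
by apply: eq_bigr => i _; rewrite curvature_scalel //; exact: smooth_coef.
Qed.

(** With V and W the matrices of the values of the fields [E i] and
    R(E i, X) Y, the endomorphism Z |-> R(Z, X) Y is V^-1 W, and [K] replaces
    D V^-1 in its trace. *)
Lemma ricci_frame X Y x : smooth_vfield X -> smooth_vfield Y ->
  D x * D x * ricci nabla X Y x =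
  D x * \sum_i \sum_j (\adj (gram x)) i j *
    pair2 g (curvature nabla (E j) X Y) (E i) x.
Proof.
move=> sX sY; have [D0|D0] := eqVneq (D x) 0; first by rewrite D0 !mul0r.
have Vu := gram_neq0_frame D0; pose W := \matrix_i curvature nabla (E i) X Y x.
have ricE : ricci_endo nabla X Y x = invmx (V x) *m W.
  apply: xget_unique => [Z sZ|A AE] /=; last first.
    have -> : W = V x *m A.
      by apply/row_matrixP => i; rewrite row_mul !rowK AE.
    by rewrite mulKmx.
  apply: (scalerI (mulf_neq0 D0 D0)); rewrite curvature_frame //.
  rewrite mulmxA mulmx_sum_row scaler_sumr; apply: eq_bigr => i _.
  rewrite rowK scalerA coefE K_invmx // -scalemxAr [in LHS]mxE.
  by rewrite mulrA.
rewrite -mulrA; congr (_ * _); rewrite /ricci ricE -mxtraceZ scalemxAl -K_invmx //.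
rewrite /K -(mulmxA (_ *m _)) mxtrace_mulC; apply: eq_bigr => i _.
rewrite -mulmxA mxE; apply: eq_bigr => j _.
rewrite mulmxA; congr (_ * _).
exact: (pair2_mx (fun k => curvature nabla (E k) X Y)).
Qed.

End Frame.

Lemma smooth_ricci X Y : (forall x, exists E : 'I_m -> vfield M, frame_at E x) ->
  smooth_vfield X -> smooth_vfield Y -> smooth_fun (ricci nabla X Y).
Proof.
move=> frames sX sY; apply: smooth_fun_quotient => x.
have [E [sE Ex]] := frames x.
pose G y := \matrix_(i, j) pair2 g (E i) (E j) y; pose D y := \det (G y).
have sG := smooth_gram sE.
have sD : smooth_fun D := smooth_fun_det sG.
exists (fun y => D y * D y), (fun y => D y * \sum_i \sum_j (\adj (G y)) i j *
  pair2 g (curvature nabla (E j) X Y) (E i) y).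
split; last by move=> y; exact: ricci_frame.
- exact: smooth_funM.
- apply: smooth_funM => //; apply: smooth_fun_sum => i; apply: smooth_fun_sum => j.
  apply: smooth_funM; first exact: smooth_fun_adj.
  exact: smooth_pair2 (metric_smooth metric_g) (smooth_curvature _ _ _) _.
- by rewrite mulf_neq0 // det_gram_neq0.
Qed.

End Curvature.

(** * Global fields dual to each other at a point *)

Lemma frame_extension (R : realType) (m : nat) (M : smooth_manifold R m)
    (E : 'I_m -> vfield M) (x : M) (v : 'rV[R]_m) : frame_at E x ->
  exists2 X : vfield M, smooth_vfield X & X x = v.
Proof.
move=> [sE Ex]; set V := (\matrix_i E i x) in Ex.
have : v *m invmx V *m V = v by rewrite mulmxKV.
move: (v *m invmx V) => u <-.
exists (fun y => \sum_i vscale (cst (u 0 i)) (E i) y).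
  by apply: smooth_vsum => i; apply: smooth_vscale (sE i); exact: smooth_fun_cst.
by rewrite mulmx_sum_row; apply: eq_bigr => i _; rewrite rowK.
Qed.

(** Three pairs of dual vectors already decide everything in
    [proportional_of_minors]. *)
Lemma dual_fields (R : realType) (m : nat) (M : smooth_manifold R m)
    (g : bilfield M) (E : 'I_m -> vfield M) (x : M) :
  (2 < m)%N -> riemannian_metric g -> frame_at E x ->
  exists e d : 'I_3 -> vfield M,
    [/\ forall i, smooth_vfield (e i), forall i, smooth_vfield (d i) &
        forall i j, pair2 g (e i) (d j) x = (i == j)%:R].
Proof.
move=> m3 metric_g frE; pose w := widen_ord m3.
have field v : {X : vfield M | smooth_vfield X /\ X x = v}.
  by apply: cid; have [X] := frame_extension v frE; exists X.
(* g(v, d j) is the component of v of index w j. *)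
pose e i := sval (field (delta_mx 0 (w i))).
pose d j := sval (field (delta_mx 0 (w j) *m (invmx (g x))^T)).
have eP i : smooth_vfield (e i) /\ e i x = _ := svalP (field _).
have dP j : smooth_vfield (d j) /\ d j x = _ := svalP (field _).
exists e, d; split=> [i|j|i j]; [exact: (eP i).1|exact: (dP j).1|].
rewrite /pair2 (eP i).2 (dP j).2 trmx_mul trmxK -!mulmxA.
rewrite (mulmxA (g x)) mulmxV ?metric_unit // mul1mx trmx_delta.
by rewrite mul_delta_mx_cond -val_eqE /= val_eqE; case: (i == j); rewrite !mxE.
Qed.

Local Close Scope classical_set_scope.

Unset Implicit Arguments.

Theorem corollary3p1 (R : realType) (m p q : nat) (M : smooth_manifold R m)
    (phi : endofield M) (Z1 Z2 : vfield M) (a1 a2 : covfield M)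
    (g : bilfield M) (nabla : vfield M -> vfield M -> vfield M)
    (hM : metric_contact_pair p q phi Z1 Z2 a1 a2 g)
    (hnormal : normal phi Z1 Z2 a1 a2)
    (hnabla : levi_civita g nabla)
    (hscal : forall x : M, scal g nabla x <> m%:R - 2)
    (hRic : forall X1 X2 X3 X4 : vfield M,
       smooth_vfield X1 -> smooth_vfield X2 ->
       smooth_vfield X3 -> smooth_vfield X4 -> forall x : M,
       ricci nabla X2 X3 x * ricci nabla X1 X4 x
         - ricci nabla X1 X3 x * ricci nabla X2 X4 x
       = 2^-1 * (scal g nabla x - m%:R + 2)
         * (pair2 g X2 X3 x * pair2 g X1 X4 x
            - pair2 g X1 X3 x * pair2 g X2 X4 x)) :
  generalized_quasi_einstein a1 a2 g nabla.
Proof.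
have [contact reeb _ _ metric_g assoc] := hM.
have [sZ1 _] := reeb_smooth reeb.
have unitZ1 x : pair2 g Z1 Z1 x = 1.
  by rewrite (associated_reeb1 assoc) // (reeb11 reeb).
have frames x : exists E : 'I_m -> vfield M, frame_at E x.
  exact: contact_pair_frame x contact.
have m3 : (2 < m)%N.
  by have [p0 q0] := type_pos contact; rewrite (contact_dim contact); lia.
exists (ricci nabla Z1 Z1), (fun=> 0), (fun=> 0).
split; [|exact: smooth_fun_cst|exact: smooth_fun_cst|].
  exact: (smooth_ricci metric_g hnabla sZ1 unitZ1 frames sZ1 sZ1).
move=> X1 X2 sX1 sX2 x; have [E frE] := frames x.
have [e [d [se sd dual]]] := dual_fields m3 metric_g frE.
have c0 : 2^-1 * (scal g nabla x - m%:R + 2) != 0.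
  rewrite mulf_neq0 ?invr_eq0 ?pnatr_eq0 //.
  by apply/eqP => /eqP; rewrite addr_eq0 subr_eq addrC => /eqP /hscal.
have [l ricE] := proportional_of_minors c0 se sd dual
  (fun Y1 Y2 Y3 Y4 s1 s2 s3 s4 => hRic Y1 Y2 Y3 Y4 s1 s2 s3 s4 x).
by rewrite !ricE // unitZ1 mulr1 !mul0r !addr0.
Qed.
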